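(* For any real $p>0$, the function $S_p$ given by the series $S_p(x)=\sum_{n=0}^{\infty}\left(\frac{T_0(2^n x)}{2^n}\right)^p$ is everywhere defined on $\mathbb{R}$ (i.e. the series converges for every $x\in\mathbb{R}$), is continuous on $\mathbb{R}$, has period $1$, and has the symmetry property $$S_p(x)=S_p(q-x)\quad\text{for all } q\in\mathbb{Z}\text{ and all } x\in\mathbb{R}.$$ In addition, for all $p>0$ and $x\in\mathbb{R}$, the inequality $|S_p(x)|\le \frac{1}{2^p-1}$ holds.
   Context: $T_0(x)$ denotes the distance from the real number $x$ to the nearest integer: $T_0(x)=|x-[x+1/2]|=\min_{m\in\mathbb{Z}}|x-m|$, where $[y]$ is the integer part (floor) of $y$. For real $p>0$, the function $S_p$ (of the Takagi power class) is given on $\mathbb{R}$ by $S_p(x)=\sum_{n=0}^{\infty}\left(\frac{T_0(2^n x)}{2^n}\right)^p$. *)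

(* Defs.v *)
From HB Require Import structures.
From mathcomp Require Import all_boot all_order all_algebra.
From mathcomp Require Import all_classical all_reals all_analysis.
From mathcomp Require Import lra.
Set Implicit Arguments.
Unset Strict Implicit.
Unset Printing Implicit Defensive.
Import Order.TTheory GRing.Theory Num.Theory.
Import numFieldNormedType.Exports.
Local Open Scope ring_scope.

Definition T0 (R : realType) (x : R) : R :=
  `|x - (Num.floor (x + 1 / 2))%:~R|.

Lemma T0_min (R : realType) (x : R) :
  (exists m : int, T0 x = `|x - m%:~R|) /\
  (forall m : int, T0 x <= `|x - m%:~R|).
Proof.
split; first by exists (Num.floor (x + 1 / 2)).
move=> m; rewrite /T0; set k := Num.floor _.
have k_le : k%:~R <= x + 1 / 2 by exact: floor_le.
have k_gt : x + 1 / 2 < k%:~R + 1 by rewrite -intrD1; exact: floorD1_gt.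
rewrite ler_norml; case: (ltgtP m k) => [|| ->]; last 1 first.
- by rewrite -ler_norml.
- rewrite -lezD1 -(ler_int R) rmorphD/= => mk.
  by have := ler_norm (x - m%:~R); lra.
- rewrite -lezD1 -(ler_int R) rmorphD/= => km.
  by have := ler_norm (m%:~R - x); rewrite distrC; lra.
Qed.

Definition Sp_term (R : realType) (p x : R) (n : nat) : R :=
  (T0 (2 ^+ n * x) / 2 ^+ n) `^ p.

(* [limn] is total: this is the sum of the series only when the partial sums
   converge. *)
Definition Sp (R : realType) (p x : R) : R := limn (series (Sp_term p x)).

(* Main.v *)
(** Since 0 <= T0 <= 1/2, the n-th term of the series lies between 0 and
    2^(-p(n+1)); these bounds do not depend on x and sum to 1/(2^p - 1), so the
    Weierstrass M-test gives convergence, continuity and the bound. T0 is even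
    and 1-periodic, so each term, hence S_p, is invariant under x |-> q - x;
    the period 1 is the composition of the reflections q = 1 and q = 0. *)

Require Import Defs.
From HB Require Import structures.
From mathcomp Require Import all_boot all_order all_algebra.
From mathcomp Require Import all_classical all_reals all_analysis.
From mathcomp Require Import lra.
Set Implicit Arguments.
Unset Strict Implicit.
Unset Printing Implicit Defensive.
Import Order.TTheory GRing.Theory Num.Theory.
Import numFieldNormedType.Exports.
Local Open Scope classical_set_scope.
Local Open Scope ring_scope.

(* [f >= 0] matters: [a `^ p = 1] for [a < 0], so [powR ^~ p] jumps at 0. *)
Lemma continuous_powRl_comp (R : realType) (T : topologicalType) (f : T -> R)
    (p : R) (x : T) :
  0 < p -> (forall y, 0 <= f y) -> {for x, continuous f} ->
  {for x, continuous (fun y => f y `^ p)}.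
Proof.
(* At a positive value of [f] the power map is differentiable; at the value 0 an epsilon argument
   takes over. *)
move=> p0 f0 fx; have [fx_gt0|fx_le0] := ltP 0 (f x).
  apply: (@continuous_comp _ _ _ f (fun a => a `^ p)) => //.
  apply/differentiable_continuous/derivable1_diffP/derivable_powR.
  by rewrite in_itv/= fx_gt0.
have fxE : f x = 0 by apply/le_anti; rewrite fx_le0 f0.
apply/cvgrPdist_lt => e e0; rewrite fxE powR0 ?gt_eqF//.
(* The power map is increasing on nonnegative reals and sends this radius to [e]. *)
have d0 : 0 < e `^ p^-1 by rewrite powR_gt0.
move/cvgrPdist_lt : fx => /(_ _ d0); rewrite fxE; apply: filterS => y.
rewrite !sub0r !normrN ger0_norm// ger0_norm ?powR_ge0// => fye.
have := gt0_ltr_powR p0 (f0 y) (ltW d0) fye.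
by rewrite -powRrM mulVf ?gt_eqF// powRr1// ltW.
Qed.

Section weierstrass_M_test.
Context {R : realType} {T : topologicalType}.
Variables (u : nat -> T -> R) (M : R ^nat).
Hypothesis uM : forall n x, `|u n x| <= M n.
Hypothesis cvgM : cvgn (series M).

Lemma dominated_series_cvg x : cvgn (series (u ^~ x)).
Proof.
apply: normed_cvg; apply: (series_le_cvg _ _ _ cvgM) => //= n.
exact: le_trans (uM n x).
Qed.

(** Compare the blocks of terms from [n] to [m] and let [m] tend to infinity. The bound is free of
    [x], which gives uniform convergence; at [n = 0] it bounds the sum itself. *)
Lemma dominated_series_tail n x :
  `|limn (series (u ^~ x)) - series (u ^~ x) n|
    <= limn (series M) - series M n.
Proof.
have cu : cvgn (series (u ^~ x)) by exact: dominated_series_cvg.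
apply: (@ler_cvg_to _ \oo _ _ (fun m => `|series (u ^~ x) m - series (u ^~ x) n|)
  (fun m => series M m - series M n)).
- by apply: cvg_norm; apply: cvgB => //; exact: cvg_cst.
- by apply: cvgB => //; exact: cvg_cst.
near=> m; have nm : (n <= m)%N by near: m; exact: nbhs_infty_ge.
rewrite !sub_series_geq//.
by apply: le_trans (ler_norm_sum _ _ _) _; apply: ler_sum.
Unshelve. all: by end_near. Qed.

Lemma dominated_series_continuous :
  (forall n, continuous (u n)) -> continuous (fun x => limn (series (u ^~ x))).
Proof.
move=> cu; apply: (@uniform_limit_continuous _ _
  ((fun n x => series (u ^~ x) n) @ \oo)).
- near_simpl; apply: nearW => n.
  apply: continuous_big => [|i _]; last exact: cu.
  exact: add_continuous.
- move=> P /uniform_nbhs[E [entE sEP]].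
  move: entE; rewrite -entourage_ballE => -[e /= e0 eE].
  (* The threshold on [n] comes from [M] alone, before the point [y] is introduced, so the
     convergence is uniform. *)
  have /cvgrPdist_lt/(_ _ e0) : series M @ \oo --> limn (series M) by [].
  apply: filterS => n /ltr_normlW lim_lt; apply: sEP => y _; apply: eE => /=.
  exact: le_lt_trans (dominated_series_tail n y) lim_lt.
Qed.

End weierstrass_M_test.

Section takagi.
Context {R : realType}.
Implicit Types (p x y : R) (m q : int).

Lemma T0_ge0 x : 0 <= T0 x. Proof. exact: normr_ge0. Qed.

Lemma T0_le_half x : T0 x <= 1 / 2.
Proof.
rewrite /T0; set k := Num.floor _.
have : k%:~R <= x + 1 / 2 by exact: floor_le.
have : x + 1 / 2 < k%:~R + 1 by rewrite -intrD1; exact: floorD1_gt.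
by rewrite ler_norml => ? ?; lra.
Qed.

(** An integer nearest to one point is a competitor in the minimum defining [T0] at the other;
    exchanging the points gives both signs. *)
Lemma T0_lipschitz x y : `|T0 x - T0 y| <= `|x - y|.
Proof.
have le (z t : R) : T0 z <= T0 t + `|z - t|.
  have [[m ->] _] := T0_min t; have [_ /(_ m) h] := T0_min z.
  apply: (le_trans h); rewrite [leRHS]addrC; apply: le_trans (ler_normD _ _).
  by rewrite addrA subrK.
by rewrite ler_norml; have := le x y; have := le y x; rewrite distrC; lra.
Qed.

Lemma T0_continuous : continuous (@T0 R).
Proof.
move=> x; apply/cvgrPdist_lt => e e0; near=> y.
apply: le_lt_trans (T0_lipschitz x y) _; near: y.
exact: (@cvgr_dist_lt _ _ _ (nbhs x)).
Unshelve. all: by end_near. Qed.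

Lemma T0_intB m x : T0 (m%:~R - x) = T0 x.
Proof.
have le (z : R) : T0 (m%:~R - z) <= T0 z.
  have [[k ->] _] := T0_min z; have [_ /(_ (m - k))] := T0_min (m%:~R - z).
  by rewrite rmorphB/= -normrN; congr (_ <= `|_|); lra.
(* The reflection is an involution, so [le] at [m - x] is the reverse inequality. *)
by apply/le_anti; rewrite le -{1}(subKr m%:~R x) le.
Qed.

Lemma Sp_term_ge0 p x n : 0 <= Sp_term p x n.
Proof. exact: powR_ge0. Qed.

(** The factor 1/2 from [T0_le_half] raises the exponent from [n] to [n.+1]; hence the leading
    coefficient of the geometric sequence equals its ratio. *)
Lemma Sp_term_le p x n : 0 < p ->
  Sp_term p x n <= geometric (2 `^ p)^-1 (2 `^ p)^-1 n.
Proof.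
move=> p0; have half_pow : ((1 / 2) ^+ n.+1) `^ p = (2 `^ p)^-1 ^+ n.+1.
  rewrite -powR_mulrn// powRAC powR_mulrn ?powR_ge0//.
  by rewrite div1r -powR_inv1// powRAC powR_inv1 ?powR_ge0.
rewrite /= -exprS -half_pow; apply: ge0_ler_powR.
- exact: ltW.
- by rewrite nnegrE divr_ge0 ?T0_ge0 ?exprn_ge0.
- by rewrite nnegrE exprn_ge0.
by rewrite exprS {2}div1r exprVn ler_pM2r ?T0_le_half// invr_gt0 exprn_gt0.
Qed.

Lemma Sp_term_continuous p n : 0 < p -> continuous (fun x => Sp_term p x n).
Proof.
move=> p0 x; apply: (@continuous_powRl_comp _ _ (fun x => T0 (2 ^+ n * x) / 2 ^+ n)) => //.
  by move=> y; rewrite divr_ge0 ?T0_ge0.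
apply: cvgM; last exact: cvg_cst.
apply: (@continuous_comp _ _ _ (fun y => 2 ^+ n * y)); last exact: T0_continuous.
exact: mulrl_continuous.
Qed.

Lemma Sp_intB p m x : Sp p (m%:~R - x) = Sp p x.
Proof.
rewrite /Sp; congr (limn (series _)); apply/funext => n; rewrite /Sp_term mulrBr; congr ((_ / _) `^ _).
have -> : 2 ^+ n * m%:~R = (2 ^+ n * m)%:~R :> R by rewrite intrM rmorphXn.
exact: T0_intB.
Qed.

End takagi.

Theorem theorem1 (R : realType) (p : R) (hp : 0 < p) :
  (forall x : R, cvgn (series (Sp_term p x))) /\
  continuous (Sp p) /\
  periodic (Sp p) 1 /\
  (forall (q : int) (x : R), Sp p x = Sp p (q%:~R - x)) /\
  (forall x : R, `|Sp p x| <= 1 / (2 `^ p - 1)).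
Proof.
have twop1 : 1 < 2 `^ p :> R.
  by have := @gt0_ltr_powR _ p hp 1 2; rewrite powR1 !nnegrE ltr1n; exact.
have twop0 : 0 < 2 `^ p :> R by exact: lt_trans twop1.
have r1 : `|(2 `^ p)^-1| < 1 :> R by rewrite gtr0_norm ?invr_gt0// invf_lt1.
have dom n x : `|Sp_term p x n| <= geometric (2 `^ p)^-1 (2 `^ p)^-1 n.
  by rewrite ger0_norm ?Sp_term_ge0// Sp_term_le.
have cvgG := is_cvg_geometric_series (a := (2 `^ p)^-1) r1.
have Sp_sym q x := Sp_intB p q x.
split; last split; last split; last split.
- exact: (dominated_series_cvg (u := fun n x => Sp_term p x n) dom cvgG).
- apply: (dominated_series_continuous (u := fun n x => Sp_term p x n) dom cvgG) => n.
  exact: Sp_term_continuous.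
- move=> x; rewrite -(Sp_sym 1) -(Sp_sym 0 x); congr (Sp p _).
  by rewrite mulr1z mulr0z; lra.
- by move=> q x; rewrite Sp_sym.
(* At index 0 the partial sums are empty, so the tail bound compares the full sums. With r = 2^(-p),
   the geometric one is r / (1 - r) = 1 / (2^p - 1). *)
- move=> x; have := dominated_series_tail (u := fun n x => Sp_term p x n) dom cvgG 0 x.
  rewrite /series/= !big_nil !subr0 => /le_trans; apply.
  have /cvg_lim -> // := cvg_geometric_series (a := (2 `^ p)^-1) r1.
  by rewrite -invfM mulrBr mulr1 mulfV ?gt_eqF// div1r.
Qed.
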